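(* Let $G=A\rtimes \langle b\rangle$ be a finite generalized dihedral group, where $A$ is a normal Abelian subgroup of $G$ and $b$ is an involution satisfying $b^{-1}ab=a^{-1}$ for every $a\in A$. Then a subgroup of $G$ is a perfect code of $G$ if and only if either it is not a subgroup of $A$ or it is a subgroup perfect code of $A$.
   Context: For a finite group $G$ with identity $1$ and a subset $S\subseteq G\setminus\{1\}$ with $S^{-1}=S$ (possibly $S=\emptyset$), the Cayley graph $\mathrm{Cay}(G,S)$ has vertex set $G$, with $x,y$ adjacent if and only if $yx^{-1}\in S$. A perfect code in a graph $\Gamma$ with vertex set $V$ is a subset $C\subseteq V$ such that no two vertices of $C$ are adjacent and every vertex in $V\setminus C$ is adjacent to exactly one vertex in $C$. A subset $C$ of $G$ is called a perfect code of $G$ if there exists such an $S$ for which $C$ is a perfect code in $\mathrm{Cay}(G,S)$; if in addition $C$ is a subgroup of $G$, it is called a subgroup perfect code of $G$. An involution is an element of order exactly $2$. $G=A\rtimes\langle b\rangle$ denotes the internal semidirect product, so $G=A\langle b\rangle$ and $A\cap\langle b\rangle=\{1\}$. *)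

(* Defs.v *)
From mathcomp Require Import all_boot all_fingroup.

Set Implicit Arguments.
Unset Strict Implicit.
Unset Printing Implicit Defensive.

Import GroupScope.

(* A graph is given by its vertex set V and an adjacency relation e, of which
   only the restriction to V matters. *)
Definition perfect_code_in (T : finType) (V : {set T}) (e : rel T)
    (C : {set T}) : Prop :=
  [/\ C \subset V,
      {in C &, forall x y, ~~ e x y}
    & {in V :\: C, forall x, exists! y, y \in C /\ e x y}].

Definition cayley_adj (gT : finGroupType) (S : {set gT}) : rel gT :=
  fun x y => y * x^-1 \in S.

(* S ranges over subsets of G, so for A a subgroup of G the connection sets
   allowed in [perfect_code_of A C] lie in A. S^-1 is the set of inverses. *)
Definition perfect_code_of (gT : finGroupType) (G : {group gT})
    (C : {set gT}) : Prop :=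
  exists S : {set gT},
    [/\ S \subset G :\ 1, S^-1 = S & perfect_code_in G (cayley_adj S) C].

Definition subgroup_perfect_code (gT : finGroupType) (G H : {group gT}) : Prop :=
  H \subset G /\ perfect_code_of G H.

(* Main.v *)
Require Import Defs.
From mathcomp Require Import all_boot all_fingroup.
Import GroupScope.

(** For a subgroup [H] of [G], a connection set [S] makes [H] a perfect code
    exactly when [S] misses [H] and meets every other right coset of [H] in
    [G] in one point: the neighbours of [x] in [H] correspond to the points
    of [S] in [H :* x^-1].  So the question is whether the right transversal
    [1 |: S] can be chosen closed under inversion.  That closure is free on
    any coset containing some [y] with [y^-1 = y], which may be chosen as
    representative.

    In a generalized dihedral group every element outside [A] is its own
    inverse.  If [H] is not contained in [A], each right coset of [H] leaves
    [A], so all representatives can be taken self-inverse.  If [H] is contained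
    in [A], the cosets outside [A] can be treated in this way, and only those
    inside [A] matter: an inverse-closed transversal for [A] extends to [G], and
    one for [G] restricts to [A].  Both constructions of a code of [G] are
    instances of [perfect_code_extend], with intermediate group [H] and [A]
    respectively; the restriction is [perfect_code_restrict]. *)

Lemma perfect_code_self {gT : finGroupType} (H : {group gT}) :
  perfect_code_of H H.
Proof.
exists set0; split; first exact: sub0set.
  by apply/setP=> x; rewrite inE !in_set0.
by split=> // [x y _ _|x]; rewrite ?setDv /cayley_adj inE.
Qed.

(** Two vertices of [B] are joined only through connection elements lying in
    [B], so the elements of [S] outside [B] can be discarded. *)
Lemma perfect_code_restrict {gT : finGroupType} {G B H : {group gT}} :
  H \subset B -> B \subset G -> perfect_code_of G H -> perfect_code_of B H.
Proof.
move=> sHB sBG [S [sSG SV [_ indep dom]]].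
have adjE x y : x \in B -> y \in B ->
    cayley_adj (S :&: B) x y = cayley_adj S x y.
  by move=> xB yB; rewrite /cayley_adj inE groupM ?groupV ?andbT.
exists (S :&: B); split.
- apply/subsetP=> x /setIP[xS xB].
  by have:= subsetP sSG x xS; rewrite !inE xB => /andP[->].
- by apply/setP=> x; rewrite inE 2!in_setI groupV -{1}SV mem_invg invgK.
split=> // [x y xH yH|x /setDP[xB xH]].
  by rewrite adjE ?(subsetP sHB) // indep.
have [|y [[yH exy] uy]] := dom x; first by rewrite inE xH (subsetP sBG).
exists y; split; first by split; rewrite // (adjE _ _ xB (subsetP sHB y yH)).
by move=> z [zH]; rewrite (adjE _ _ xB (subsetP sHB z zH)) => exz; apply: uy.
Qed.

(** A connection set for [B] already serves the cosets of [H] inside [B]; a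
    self-inverse representative of each remaining coset is added to it.  These
    lie outside [B], hence create no edge within [B]. *)
Lemma perfect_code_extend {gT : finGroupType} {G B H : {group gT}} :
    H \subset B -> B \subset G ->
    {in G :\: B, forall x, exists2 y, y \in H :* x & y^-1 = y} ->
  perfect_code_of B H -> perfect_code_of G H.
Proof.
move=> sHB sBG selfinv [S0 [sS0B S0V [_ indep dom]]].
pose f (C : {set gT}) := odflt 1 [pick y in C | y^-1 == y].
have fP x : x \in G :\: B ->
    (f (H :* x) \in H :* x) * ((f (H :* x))^-1 = f (H :* x)).
  move=> /selfinv[y yHx yV]; rewrite /f; case: pickP => [z /andP[-> /eqP->] //|].
  by move=> /(_ y); rewrite yHx yV eqxx.
pose T := [set f (H :* x) | x in G :\: B].
have TGB t : t \in T -> t \in G :\: B.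
  move=> /imsetP[x xGB ->]; have [/rcosetP[h hH ->] _] := fP x xGB.
  have hB := subsetP sHB h hH; have hG := subsetP sBG h hB.
  by move: xGB; rewrite !inE !groupMl.
have TV t : t \in T -> t^-1 = t by move=> /imsetP[x /fP[_ ? ->]].
have TS0 z : z \in B -> (z \in S0 :|: T) = (z \in S0).
  move=> zB; rewrite inE; case: (boolP (z \in T)) => [/TGB|]; last by rewrite orbF.
  by rewrite inE zB.
have adjE x y : x \in B -> y \in B ->
    cayley_adj (S0 :|: T) x y = cayley_adj S0 x y.
  by move=> xB yB; rewrite /cayley_adj TS0 // groupM ?groupV.
exists (S0 :|: T); split.
- apply/subsetP=> z /setUP[/(subsetP sS0B)|/TGB]; rewrite !inE.
    by move=> /andP[-> /(subsetP sBG)].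
  by move=> /andP[zB ->]; rewrite andbT; apply: contraNneq zB => ->.
- have VT z : (z^-1 \in T) = (z \in T).
    by apply/idP/idP=> zT; [rewrite -(invgK z)|]; rewrite (TV _ zT).
  by apply/setP=> z; rewrite inE !in_setU VT -{1}S0V mem_invg invgK.
split=> [|x y xH yH|x /setDP[xG xH]]; first exact: subset_trans sBG.
  by rewrite adjE ?(subsetP sHB) // indep.
case: (boolP (x \in B)) => xB.
  have [|y [[yH exy] uy]] := dom x; first by rewrite inE xH.
  exists y; split; first by split; rewrite // (adjE _ _ xB (subsetP sHB y yH)).
  by move=> z [zH]; rewrite (adjE _ _ xB (subsetP sHB z zH)) => exz; apply: uy.
have xVGB : x^-1 \in G :\: B by rewrite inE !groupV xB.
(* The edge from x to y is labelled by the representative of H :* x^-1. *)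
exists (f (H :* x^-1) * x); split.
  have [fHx _] := fP _ xVGB; split.
    by move: fHx; rewrite mem_rcoset invgK.
  by rewrite /cayley_adj mulgK inE [X in _ || X]imset_f ?orbT.
move=> y [yH]; rewrite /cayley_adj inE => /orP[/(subsetP sS0B)|].
  by rewrite !inE (groupMl _ (subsetP sHB y yH)) groupV (negPf xB) andbF.
move=> /imsetP[z zGB def_yx]; have [] := fP z zGB.
rewrite -def_yx => /rcoset_eqP eqHz _.
have: y * x^-1 \in H :* x^-1 by rewrite mem_rcoset mulgK.
by move=> /rcoset_eqP eqHx; rewrite -eqHx eqHz -def_yx mulgKV.
Qed.

(** An element outside [A] is [a * b] with [a] in [A], and conjugation by the
    involution [b] turns [a^-1] into [a]. *)
Lemma gen_dihedral_selfinv {gT : finGroupType} {G A : {group gT}} {b : gT} :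
    A ><| <[b]> = G -> #[b] = 2 ->
    (forall a, a \in A -> b^-1 * a * b = a^-1) ->
  {in G :\: A, forall x, x^-1 = x}.
Proof.
move=> sdG ob invb x /setDP[]; have [_ <- _ _] := sdprodP sdG.
have bV : b^-1 = b by rewrite invg_expg ob.
move=> /mulsgP[a y aA + ->]; rewrite cycle2g // !inE.
move=> /orP[] /eqP->; first by rewrite mulg1 aA.
by rewrite invMg -(invb a aA) {1}bV -!mulgA mulKVg.
Qed.

Theorem theorem5p2 (gT : finGroupType) (G A : {group gT}) (b : gT)
    (sdG : A ><| <[b]> = G) (abA : abelian A) (ob : #[b] = 2)
    (invb : forall a, a \in A -> b^-1 * a * b = a^-1)
    (H : {group gT}) (sHG : H \subset G) :
  perfect_code_of G H <-> (~~ (H \subset A) \/ subgroup_perfect_code A H).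
Proof.
have sAG : A \subset G by have [/andP[]] := sdprod_context sdG.
have selfinv := gen_dihedral_selfinv sdG ob invb.
split=> [codeG|[/subsetPn[c cH cA]|[sHA codeA]]].
- case: (boolP (H \subset A)) => sHA; [right | by left].
  by split=> //; apply: perfect_code_restrict codeG.
- apply: (perfect_code_extend (subxx H) sHG _ (perfect_code_self H)).
  move=> x /setDP[xG _]; case: (boolP (x \in A)) => xA.
    (* Left multiplication by c moves x out of A within its coset. *)
    exists (c * x); first by rewrite mem_rcoset mulgK.
    by apply: selfinv; rewrite inE groupMr ?cA ?groupM ?(subsetP sHG c cH).
  by exists x; rewrite ?rcoset_refl //; apply: selfinv; rewrite inE xA.
apply: (perfect_code_extend sHA sAG _ codeA).
by move=> x xGA; exists x; rewrite ?rcoset_refl //; apply: selfinv.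
Qed.
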